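(* Let $b>0$, $\delta>0$, $\eta>0$ and $0\le v<1$ be real constants, and let $y(x,t)\in\mathbb{R}$ be the solution of the initial-boundary value problem $$y_{tt}+2\delta y_t+2v\,y_{xt}=\Big[1-v^2+\tfrac32 b\,y_x^2\Big]y_{xx}+2\eta\,y_x y_{xx}y_{xt}+\eta\,y_x^2\,y_{xxt},\qquad x\in(0,1),\ t\ge 0,$$ with boundary conditions $y(0,t)=y(1,t)=0$ for all $t\ge0$ and initial conditions $y(x,0)=f(x)$, $y_t(x,0)=g(x)$ for all $x\in(0,1)$, where $f\in C^1[0,1]$ and at least one of $f,g$ is not identically zero over $[0,1]$. Define, for $t\ge0$, $$E(t)=\int_0^1\tfrac12 y_t^2\,dx+\int_0^1\tfrac12(1-v^2)y_x^2\,dx+\int_0^1\tfrac b8 y_x^4\,dx,$$ $$V(t)=E(t)+\delta\int_0^1\Big[y\,y_t+\delta y^2+\tfrac{\eta}{4}y_x^4\Big]dx,$$ and $$K=1+\delta\max\Big\{\frac{1+2\delta/\pi}{\pi(1-v^2)},\ \frac{2\eta}{b}\Big\}.$$ If $0\le v<v_c:=\dfrac{\sqrt5-1}{2}$, then $$V(t)\le V(0)\exp\Big(-\frac{2\delta(1-v-v^2)}{K(1-v^2)}\,t\Big)\qquad\text{for all } t\ge0;$$ that is, $V$ tends to zero exponentially.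
   Context: Subscripts denote partial derivatives, e.g. $y_x=\partial y/\partial x$, $y_{xt}=\partial^2y/\partial x\partial t$, $y_{xxt}=\partial^3 y/\partial x^2\partial t$; functions under integrals are evaluated at $(x,t)$. The problem models a nonlinear axially moving string between two fixed eyelets with viscous damping $\delta$, Kelvin-Voigt damping $\eta$, and axial speed proportional to $v$. A solution is understood to be regular enough on $[0,1]\times[0,\infty)$ that all displayed derivatives exist, the boundary and initial conditions hold in the classical sense, and integration by parts in $x$ and differentiation in $t$ under the integrals defining $E$ and $V$ are legitimate. *)

(* Defs.v *)
From Stdlib Require Import Reals.
From Coquelicot Require Import Coquelicot.
Open Scope R_scope.

Definition unit_interval (x : R) : Prop := 0 <= x <= 1.
Definition half_line (t : R) : Prop := 0 <= t.
Definition strip (p : R * R) : Prop := unit_interval (fst p) /\ half_line (snd p).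

(* Functions of (x, t) only matter on the strip [0,1] x [0,oo). [D_in] takes the
   difference quotient inside the given set, so derivatives are one-sided at
   x = 0, x = 1 and t = 0, and are uniquely determined on the strip. *)
Definition partial_x (u ux : R -> R -> R) : Prop :=
  forall x t, unit_interval x -> half_line t ->
    D_in (fun s => u s t) (fun s => ux s t) unit_interval x.

Definition partial_t (u ut : R -> R -> R) : Prop :=
  forall x t, unit_interval x -> half_line t ->
    D_in (fun s => u x s) (fun s => ut x s) half_line t.

Definition continuous_strip (u : R -> R -> R) : Prop :=
  continuous_on strip (fun p : R * R => u (fst p) (snd p)).

Definition C1_unit_interval (f : R -> R) : Prop :=
  exists f' : R -> R,
    (forall x, unit_interval x -> D_in f f' unit_interval x) /\
    continuous_on unit_interval f'.

(* Every derivative occurring in the equation exists and is jointly continuous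
   up to the boundary; this is what makes integration by parts in x and
   differentiation in t under the energy integrals legitimate. The mixed
   derivatives are d/dx (dy/dt) and d^2/dx^2 (dy/dt). *)
Record classical_regularity (y yx yt yxx yxt ytt yxxt : R -> R -> R) : Prop := {
  reg_x : partial_x y yx;
  reg_t : partial_t y yt;
  reg_xx : partial_x yx yxx;
  reg_xt : partial_x yt yxt;
  reg_tt : partial_t yt ytt;
  reg_xxt : partial_x yxt yxxt;
  cont_y : continuous_strip y;
  cont_x : continuous_strip yx;
  cont_t : continuous_strip yt;
  cont_xx : continuous_strip yxx;
  cont_xt : continuous_strip yxt;
  cont_tt : continuous_strip ytt;
  cont_xxt : continuous_strip yxxt
}.

Definition string_equation (b delta eta v : R)
    (yx yt yxx yxt ytt yxxt : R -> R -> R) : Prop :=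
  forall x t, 0 < x < 1 -> 0 <= t ->
    ytt x t + 2 * delta * yt x t + 2 * v * yxt x t
    = (1 - v ^ 2 + 3 / 2 * b * yx x t ^ 2) * yxx x t
      + 2 * eta * yx x t * yxx x t * yxt x t
      + eta * yx x t ^ 2 * yxxt x t.

Definition fixed_ends (y : R -> R -> R) : Prop :=
  forall t, 0 <= t -> y 0 t = 0 /\ y 1 t = 0.

Definition initial_data (f g : R -> R) (y yt : R -> R -> R) : Prop :=
  forall x, 0 < x < 1 -> y x 0 = f x /\ yt x 0 = g x.

Definition energy (b v : R) (yx yt : R -> R -> R) (t : R) : R :=
  RInt (fun x => 1 / 2 * yt x t ^ 2) 0 1
  + RInt (fun x => 1 / 2 * (1 - v ^ 2) * yx x t ^ 2) 0 1
  + RInt (fun x => b / 8 * yx x t ^ 4) 0 1.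

Definition lyapunov (b delta eta v : R) (y yx yt : R -> R -> R) (t : R) : R :=
  energy b v yx yt t
  + delta * RInt (fun x => y x t * yt x t + delta * y x t ^ 2
                           + eta / 4 * yx x t ^ 4) 0 1.

Definition K_const (b delta eta v : R) : R :=
  1 + delta * Rmax ((1 + 2 * delta / PI) / (PI * (1 - v ^ 2))) (2 * eta / b).

Definition v_crit : R := (sqrt 5 - 1) / 2.

Definition tends_to_zero_exponentially (V : R -> R) : Prop :=
  exists C lambda : R, 0 < lambda /\
    forall t, 0 <= t -> Rabs (V t) <= C * exp (- lambda * t).

(* Main.v *)
Require Import Defs.
From Stdlib Require Import Reals Psatz.
From Coquelicot Require Import Coquelicot.
Open Scope R_scope.

(* The right-hand side of the equation is the x-derivative of
   [P = (1 - v^2) y_x + b/2 y_x^3 + eta y_x^2 y_xt]. Multiplying by [y_t + delta y] and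
   integrating by parts, the boundary terms vanish and
     [V' = delta * int (- y_t^2 + 2 v y_x y_t - (1 - v^2) y_x^2 - b/2 y_x^4)
           - eta * int y_x^2 y_xt^2].
   Since [2 y_x y_t <= y_x^2 + y_t^2], this is at most [- 2 delta c E] with
   [c = (1 - v - v^2) / (1 - v^2)], which is positive for [v < v_c]. Wirtinger's inequality
   [PI^2 int y^2 <= int y_x^2] gives [V <= K E], so [V' <= - (2 delta c / K) V], and
   Gronwall's lemma concludes. *)

(** * Clipping, the fundamental theorem of calculus and Gronwall's lemma *)

Definition clip (a b x : R) : R := Rmax a (Rmin b x).

Lemma clip_range (a b x : R) : a <= b -> a <= clip a b x <= b.
Proof.
  intros Hab; unfold clip, Rmax, Rmin.
  repeat destruct Rle_dec; lra.
Qed.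

Lemma clip_id (a b x : R) : a <= x <= b -> clip a b x = x.
Proof.
  intros Hx; unfold clip, Rmax, Rmin.
  repeat destruct Rle_dec; lra.
Qed.

Lemma clip_lipschitz (a b x z : R) : Rabs (clip a b z - clip a b x) <= Rabs (z - x).
Proof.
  unfold clip, Rmax, Rmin.
  repeat destruct Rle_dec; unfold Rabs; repeat destruct Rcase_abs; lra.
Qed.

Lemma continuous_clip (a b x : R) : continuous (clip a b) x.
Proof.
  apply filterlim_locally; intros eps; exists eps; intros z Hz.
  apply Rle_lt_trans with (Rabs (z - x)); [apply clip_lipschitz|exact Hz].
Qed.

Lemma ex_RInt_of_continuous (f : R -> R) (a b : R) :
  (forall x, continuous f x) -> ex_RInt f a b.
Proof.
  intros Cf; apply (ex_RInt_continuous (V := R_CompleteNormedModule)); auto.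
Qed.

(** Derivatives at the edges of the strip are one-sided, so differentiability is assumed only
    inside. The difference between [f] and the integral of [df] has zero derivative there and is
    continuous up to the ends, hence constant. *)
Lemma RInt_is_derive_interior (f df : R -> R) (a b : R) :
  a <= b ->
  (forall x, a <= x <= b -> continuous f x) ->
  (forall x, a <= x <= b -> continuous df x) ->
  (forall x, a < x < b -> is_derive f x (df x)) ->
  RInt df a b = f b - f a.
Proof.
  intros Hab Cf Cdf Df.
  (* Clipping makes the integrand continuous on the whole line without changing it on [a, b], so its
     integral is differentiable everywhere. *)
  set (g := fun x => df (clip a b x)).
  assert (Cg : forall x, continuous g x).
  { intros x; apply (continuous_comp (clip a b) df).
    - apply continuous_clip.
    - apply Cdf, clip_range, Hab. }
  assert (Ig : forall u v, ex_RInt g u v) by (intros; apply ex_RInt_of_continuous, Cg).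
  assert (DI : forall x, is_derive (RInt g a) x (g x)).
  { intros x; apply (is_derive_RInt g (RInt g a) a); [|apply Cg].
    apply filter_forall; intros; apply (RInt_correct (V := R_CompleteNormedModule)), Ig. }
  rewrite (RInt_ext df g).
  2:{ rewrite Rmin_left, Rmax_right by lra; intros x Hx; unfold g; rewrite clip_id by lra; auto. }
  destruct (MVT_gen (fun x => f x - RInt g a x) a b (fun _ => 0)) as [c [_ Hc]].
  - rewrite Rmin_left, Rmax_right by lra; intros x Hx.
    replace 0 with (df x - g x) by (unfold g; rewrite clip_id by lra; ring).
    apply (is_derive_minus f (RInt g a)); auto.
  - rewrite Rmin_left, Rmax_right by lra; intros x Hx.
    apply continuity_pt_filterlim, (continuous_minus f (RInt g a)).
    + auto.
    + apply ex_derive_continuous; eexists; apply DI.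
  - rewrite (RInt_point a g) in Hc; unfold zero in Hc; simpl in Hc; lra.
Qed.

Lemma decreasing_of_is_derive_nonpos (f df : R -> R) (a b : R) :
  a <= b ->
  (forall x, a <= x <= b -> continuous f x) ->
  (forall x, a < x < b -> is_derive f x (df x)) ->
  (forall x, a < x < b -> df x <= 0) ->
  f b <= f a.
Proof.
  intros Hab Cf Df Hneg.
  destruct (Req_dec a b) as [<-|Hne]; [lra|].
  (* The mean value point may be an endpoint, where the sign of [df] is unknown; [Rmin 0] forces the
     sign there and changes nothing inside. *)
  destruct (MVT_gen f a b (fun x => Rmin 0 (df x))) as [c [_ Hc]].
  - rewrite Rmin_left, Rmax_right by lra; intros x Hx.
    rewrite Rmin_right by auto; auto.
  - rewrite Rmin_left, Rmax_right by lra; intros x Hx.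
    apply continuity_pt_filterlim, Cf, Hx.
  - pose proof (Rmin_l 0 (df c)); nra.
Qed.

(** With the integrating factor, [W t * exp (r * t)] has nonpositive derivative. *)
Lemma gronwall_exp (W dW : R -> R) (r T : R) :
  0 <= T ->
  (forall t, 0 <= t <= T -> continuous W t) ->
  (forall t, 0 < t < T -> is_derive W t (dW t)) ->
  (forall t, 0 < t < T -> dW t <= - r * W t) ->
  W T <= W 0 * exp (- r * T).
Proof.
  intros HT CW DW Hle.
  assert (H : W T * exp (r * T) <= W 0 * exp (r * 0)).
  { apply (decreasing_of_is_derive_nonpos (fun t => W t * exp (r * t))
             (fun t => (dW t + r * W t) * exp (r * t))); auto.
    - intros t Ht; apply (continuous_mult W (fun t => exp (r * t))); auto.
      apply (ex_derive_continuous (fun t : R => exp (r * t) : R)); auto_derive; auto.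
    - intros t Ht; pose proof (DW t Ht) as D.
      auto_derive; [eexists; apply D|rewrite (is_derive_unique (fun x : R => W x) _ _ D); ring].
    - intros t Ht; pose proof (Hle t Ht); pose proof (exp_pos (r * t)); nra. }
  rewrite Rmult_0_r, exp_0 in H.
  replace (- r * T) with (- (r * T)) by ring; rewrite exp_Ropp.
  pose proof (exp_pos (r * T)).
  apply Rmult_le_reg_r with (exp (r * T)); auto.
  rewrite Rmult_assoc, Rinv_l; lra.
Qed.

(** * Joint continuity and integrals depending on a parameter *)

Lemma continuous_snd_of_continuity_2d (F : R -> R -> R) (x t : R) :
  continuity_2d_pt F x t -> continuous (F x) t.
Proof.
  intros H; apply filterlim_locally; intros eps.
  destruct (H eps) as [d Hd]; exists d; intros s Hs.
  apply Hd; [|exact Hs].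
  replace (x - x) with 0 by ring; rewrite Rabs_R0; apply cond_pos.
Qed.

Lemma continuous_fst_of_continuity_2d (F : R -> R -> R) (x t : R) :
  continuity_2d_pt F x t -> continuous (fun s => F s t) x.
Proof.
  intros H; apply filterlim_locally; intros eps.
  destruct (H eps) as [d Hd]; exists d; intros s Hs.
  apply Hd; [exact Hs|].
  replace (t - t) with 0 by ring; rewrite Rabs_R0; apply cond_pos.
Qed.

(** The motion takes its arguments in the order (x, t), whereas the parameter of an integral, here
    time, comes first in the lemmas below. *)
Lemma continuity_2d_pt_swap (F : R -> R -> R) (x t : R) :
  continuity_2d_pt F x t -> continuity_2d_pt (fun s z => F z s) t x.
Proof.
  intros H eps; destruct (H eps) as [d Hd]; exists d; intros u v Hu Hv; auto.
Qed.

Lemma continuity_2d_pt_pow (F : R -> R -> R) (n : nat) (x t : R) :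
  continuity_2d_pt F x t -> continuity_2d_pt (fun u v => F u v ^ n) x t.
Proof.
  intros H; induction n as [|n IH]; simpl.
  - apply continuity_2d_pt_const.
  - apply continuity_2d_pt_mult; auto.
Qed.

Ltac continuity_2d :=
  repeat first
    [ assumption | apply continuity_2d_pt_const | apply continuity_2d_pt_plus
    | apply continuity_2d_pt_minus | apply continuity_2d_pt_opp
    | apply continuity_2d_pt_mult | apply continuity_2d_pt_pow ].

(** By compactness of [a, b], [F u] is uniformly close to [F s] on it when u is near s. *)
Lemma continuous_RInt_param (F : R -> R -> R) (a b s : R) :
  a <= b ->
  (forall u x, continuity_2d_pt F u x) ->
  continuous (fun u => RInt (F u) a b) s.
Proof.
  intros Hab CF.
  assert (IF : forall u, ex_RInt (F u) a b).
  { intros u; apply ex_RInt_of_continuous; intros; apply continuous_snd_of_continuity_2d; auto. }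
  apply filterlim_locally; intros eps.
  (* The added 1 covers the case a = b and makes the final bound strictly less than [eps]. *)
  assert (He : 0 < eps / (b - a + 1)) by (apply Rdiv_lt_0_compat; [apply cond_pos|lra]).
  destruct (uniform_continuity_2d_1d' F a b s (fun x _ => CF s x) (mkposreal _ He)) as [d Hd].
  exists d; intros u Hu.
  assert (Hu' : Rabs (u - s) < d) by exact Hu.
  apply Rabs_def2 in Hu'.
  change (Rabs (RInt (F u) a b - RInt (F s) a b) < eps).
  rewrite <- (RInt_minus (F u) (F s)) by auto.
  apply Rle_lt_trans with ((b - a) * (eps / (b - a + 1))).
  - apply (abs_RInt_le_const (fun x => F u x - F s x)); auto.
    + apply (ex_RInt_minus (F u) (F s)); auto.
    + intros x Hx; left; apply Hd; try lra.
      replace (x - x) with 0 by ring; rewrite Rabs_R0; apply cond_pos.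
  - pose proof (cond_pos eps).
    replace ((b - a) * (eps / (b - a + 1))) with (eps - eps / (b - a + 1)) by (field; lra).
    lra.
Qed.

(** Differentiation under the integral needs [Derive] to be jointly continuous around each (s, x),
    also for x slightly outside [a, b], where [D] says nothing. Clipping x makes the derivative
    formula valid for every x and leaves the integrals unchanged. *)
Lemma is_derive_RInt_continuous_param (F dF : R -> R -> R) (a b l r s : R) :
  a <= b -> l < s < r ->
  (forall u x, continuity_2d_pt F u x) ->
  (forall u x, continuity_2d_pt dF u x) ->
  (forall u x, l < u < r -> a <= x <= b -> is_derive (fun z => F z x) u (dF u x)) ->
  is_derive (fun u => RInt (F u) a b) s (RInt (dF s) a b).
Proof.
  intros Hab Hs CF CdF D.
  set (G := fun u x => F u (clip a b x)).
  set (dG := fun u x => dF u (clip a b x)).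
  assert (DG : forall u x, l < u < r -> is_derive (fun z => G z x) u (dG u x)).
  { intros u x Hu; apply D; auto; apply clip_range, Hab. }
  assert (Cclip : forall H, (forall u x, continuity_2d_pt H u x) ->
            forall u x, continuity_2d_pt (fun u x => H u (clip a b x)) u x).
  { intros H CH u x eps; destruct (CH u (clip a b x) eps) as [d Hd].
    exists d; intros v z Hv Hz; apply Hd; auto.
    apply Rle_lt_trans with (Rabs (z - x)); [apply clip_lipschitz|auto]. }
  assert (Heq : forall (H : R -> R -> R) u, RInt (H u) a b = RInt (fun x => H u (clip a b x)) a b).
  { intros H u; apply RInt_ext; rewrite Rmin_left, Rmax_right by lra.
    intros x Hx; rewrite clip_id by lra; auto. }
  rewrite Heq.
  apply (is_derive_ext (fun u => RInt (G u) a b)); [intros u; symmetry; apply Heq|].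
  assert (Hloc : locally s (fun u => l < u < r)).
  { apply filter_and; [apply (open_gt l); lra|apply (open_lt r); lra]. }
  replace (RInt (fun x => dF s (clip a b x)) a b)
    with (RInt (fun x => Derive (fun u => G u x) s) a b).
  2:{ apply RInt_ext; intros; apply is_derive_unique, DG, Hs. }
  apply (is_derive_RInt_param G).
  - revert Hloc; apply filter_imp; intros u Hu x _; eexists; apply DG, Hu.
  - intros x _; apply continuity_2d_pt_ext_loc with dG; [|apply (Cclip dF CdF)].
    destruct Hloc as [d Hd]; exists d; intros u z Hu _.
    symmetry; apply is_derive_unique, DG, Hd, Hu.
  - apply filter_forall; intros u; apply ex_RInt_of_continuous; intros x.
    apply continuous_snd_of_continuity_2d, (Cclip F CF).
Qed.

Lemma RInt_Rplus (f g : R -> R) (a b : R) :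
  ex_RInt f a b -> ex_RInt g a b ->
  RInt (fun x => f x + g x) a b = RInt f a b + RInt g a b.
Proof. exact (RInt_plus (V := R_CompleteNormedModule) f g a b). Qed.

Lemma RInt_Rmult (c : R) (f : R -> R) (a b : R) :
  ex_RInt f a b -> RInt (fun x => c * f x) a b = c * RInt f a b.
Proof. exact (RInt_scal (V := R_CompleteNormedModule) f a b c). Qed.

Lemma continuity_2d_pt_of_continuous (f : R -> R) (x t : R) :
  continuous f x -> continuity_2d_pt (fun u _ => f u) x t.
Proof.
  intros Cf; apply (continuity_1d_2d_pt_comp f (fun u _ => u)).
  - apply continuity_pt_filterlim, Cf.
  - apply continuity_2d_pt_id1.
Qed.

(** A one-variable function is read as a function of two variables constant in the second, so that
    [continuity_2d] decomposes it. *)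
Ltac continuity_1d :=
  match goal with
  | |- continuous ?f ?x => apply (continuous_fst_of_continuity_2d (fun u _ => f u) x 0)
  end;
  continuity_2d; apply continuity_2d_pt_of_continuous.

(** * Wirtinger's inequality *)

Lemma wirtinger_below_PI (u du : R -> R) (mu : R) :
  0 < mu < PI ->
  (forall x, continuous u x) -> (forall x, continuous du x) ->
  (forall x, 0 < x < 1 -> is_derive u x (du x)) ->
  u 0 = 0 -> u 1 = 0 ->
  mu ^ 2 * RInt (fun x => u x ^ 2) 0 1 <= RInt (fun x => du x ^ 2) 0 1.
Proof.
  intros Hmu Cu Cdu Du U0 U1.
  (* [w] solves the Riccati equation [w' = - mu^2 - w^2] on all of [0,1] because [mu < PI];
     then [du^2 - mu^2 u^2 - (u^2 w)' = (du - u w)^2]. *)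
  set (c := fun x : R => cos (mu * (x - 1 / 2))).
  set (w := fun x : R => - mu * (sin (mu * (x - 1 / 2)) / c x)).
  assert (Hc : forall x, 0 <= x <= 1 -> c x <> 0).
  { intros x Hx; apply Rgt_not_eq, cos_gt_0; nra. }
  assert (Dw : forall x, 0 <= x <= 1 -> is_derive w x (- mu ^ 2 - w x ^ 2)).
  { intros x Hx; pose proof (Hc x Hx) as N; unfold w, c in *.
    auto_derive; [exact N|].
    replace (mu * (x + - (1 / 2))) with (mu * (x - 1 / 2)) by ring.
    field; exact N. }
  assert (Cw : forall x, 0 <= x <= 1 -> continuous w x).
  { intros x Hx; apply (ex_derive_continuous w); eexists; apply Dw, Hx. }
  clearbody w.
  (* This is the derivative of u^2 w with w' replaced through the Riccati equation; it integrates to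
     0 because u vanishes at both ends. *)
  set (dH := fun x : R => 2 * u x * du x * w x - u x ^ 2 * (mu ^ 2 + w x ^ 2)).
  assert (CdH : forall x, 0 <= x <= 1 -> continuous dH x).
  { intros x Hx.
    unfold dH; continuity_1d; auto. }
  assert (I : RInt dH 0 1 = 0).
  { rewrite (RInt_is_derive_interior (fun x => u x ^ 2 * w x) dH); auto; try lra.
    - rewrite U0, U1; change (0 ^ 2 * w 1 - 0 ^ 2 * w 0 = 0 :> R); ring.
    - intros x Hx; continuity_1d; auto.
    - intros x Hx.
      pose proof (Du x Hx) as D1; assert (D2 := Dw x ltac:(lra)).
      auto_derive; [split; [|split]; trivial; eexists; eassumption|].
      rewrite (is_derive_unique (fun z : R => u z) _ _ D1).
      rewrite (is_derive_unique (fun z : R => w z) _ _ D2).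
      unfold dH; ring. }
  assert (Cpow : forall f : R -> R, (forall x, continuous f x) -> forall x, continuous (fun z => f z ^ 2) x).
  { intros f Cf x; continuity_1d; auto. }
  assert (I1 : ex_RInt (fun x => mu ^ 2 * u x ^ 2) 0 1).
  { apply (ex_RInt_scal (fun x => u x ^ 2)), ex_RInt_of_continuous, Cpow, Cu. }
  assert (I2 : ex_RInt dH 0 1).
  { apply (ex_RInt_continuous (V := R_CompleteNormedModule)).
    rewrite Rmin_left, Rmax_right by lra; auto. }
  rewrite <- RInt_Rmult by (apply ex_RInt_of_continuous, Cpow, Cu).
  replace (RInt (fun x => mu ^ 2 * u x ^ 2) 0 1)
    with (RInt (fun x => mu ^ 2 * u x ^ 2) 0 1 + RInt dH 0 1) by lra.
  rewrite <- RInt_Rplus by auto.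
  apply RInt_le; [lra| | |].
  - apply (ex_RInt_plus (fun x => mu ^ 2 * u x ^ 2) dH); auto.
  - apply ex_RInt_of_continuous, Cpow, Cdu.
  - intros x Hx; unfold dH.
    pose proof (pow2_ge_0 (du x - u x * w x)); nra.
Qed.

(** Limit mu -> PI of the previous lemma: if the inequality failed at PI, it would already fail for
    some mu slightly below. *)
Lemma wirtinger (u du : R -> R) :
  (forall x, continuous u x) -> (forall x, continuous du x) ->
  (forall x, 0 < x < 1 -> is_derive u x (du x)) ->
  u 0 = 0 -> u 1 = 0 ->
  PI ^ 2 * RInt (fun x => u x ^ 2) 0 1 <= RInt (fun x => du x ^ 2) 0 1.
Proof.
  intros Cu Cdu Du U0 U1.
  set (A := RInt (fun x => u x ^ 2) 0 1); set (B := RInt (fun x => du x ^ 2) 0 1).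
  pose proof PI_RGT_0 as HPI.
  destruct (Rle_lt_dec (PI ^ 2 * A) B) as [|Hlt]; auto; exfalso.
  assert (C : continuity_pt (fun m : R => m ^ 2 * A) PI) by reg.
  destruct (C (PI ^ 2 * A - B)) as [d [Hd Hcont]]; [lra|].
  (* A point of (0, PI) at distance less than d from PI; [PI / 2] keeps it positive when d is
     large. *)
  set (m := Rmax (PI / 2) (PI - d / 2)).
  assert (Hm : 0 < m < PI /\ PI - d < m).
  { unfold m, Rmax; destruct Rle_dec; lra. }
  pose proof (wirtinger_below_PI u du m (proj1 Hm) Cu Cdu Du U0 U1) as W.
  assert (Hd' : Rabs (m ^ 2 * A - PI ^ 2 * A) < PI ^ 2 * A - B).
  { apply Hcont; split; [split; [exact I|lra]|].
    simpl; unfold Rdist; apply Rabs_def1; lra. }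
  apply Rabs_def2 in Hd'; fold A B in W; lra.
Qed.

(** * Exchange of mixed partial derivatives *)

Lemma continuous_zero_endpoints (f : R -> R) :
  (forall x, continuous f x) -> (forall x, 0 < x < 1 -> f x = 0) ->
  forall x, 0 <= x <= 1 -> f x = 0.
Proof.
  intros Cf Z.
  assert (D : forall x, 0 < x < 1 -> is_derive f x 0).
  { intros x Hx; apply (is_derive_ext_loc (fun _ => 0)); [|apply (is_derive_const (V := R_NormedModule))].
    apply (filter_imp (fun z => 0 < z < 1)); [intros z Hz; symmetry; auto|].
    apply filter_and; [apply (open_gt 0); lra|apply (open_lt 1); lra]. }
  assert (H : forall a b, 0 <= a <= b -> b <= 1 -> f b = f a).
  { intros a b Ha Hb.
    assert (E : RInt (fun _ => 0) a b = f b - f a).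
    { apply RInt_is_derive_interior; auto; try lra.
      - intros; apply continuous_const.
      - intros x Hx; apply D; lra. }
    rewrite (RInt_const (V := R_CompleteNormedModule)) in E; unfold scal in E; simpl in E.
    unfold mult in E; simpl in E; lra. }
  assert (Z2 : f (1 / 2) = 0) by (apply Z; lra).
  intros x Hx; destruct (Rle_lt_dec x (1 / 2)).
  - rewrite <- (H x (1 / 2)); lra.
  - rewrite (H (1 / 2) x); lra.
Qed.

(* For [0 < s < r], both sides of [yx x r - yx x s = RInt (yxt x) s r] are the [x]-derivative
   of [y x r - y x s]; continuity extends this to [x = 0] and [x = 1]. *)
Lemma is_derive_mixed_partial (y yx yt yxt : R -> R -> R) :
  (forall x t, continuity_2d_pt yx x t) ->
  (forall x t, continuity_2d_pt yt x t) ->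
  (forall x t, continuity_2d_pt yxt x t) ->
  (forall x t, 0 < x < 1 -> 0 < t -> is_derive (fun s => y s t) x (yx x t)) ->
  (forall x t, 0 <= x <= 1 -> 0 < t -> is_derive (y x) t (yt x t)) ->
  (forall x t, 0 < x < 1 -> 0 < t -> is_derive (fun s => yt s t) x (yxt x t)) ->
  forall x t, 0 <= x <= 1 -> 0 < t -> is_derive (yx x) t (yxt x t).
Proof.
  intros Cx Ct Cxt Dx Dt Dxt.
  assert (H : forall s r, 0 < s <= r -> forall x, 0 <= x <= 1 ->
            yx x r - yx x s - RInt (yxt x) s r = 0).
  { intros s r Hs; apply continuous_zero_endpoints.
    - intros x; apply (continuous_minus (fun x => yx x r - yx x s) (fun x => RInt (yxt x) s r)).
      + apply (continuous_minus (fun x => yx x r) (fun x => yx x s));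
          apply continuous_fst_of_continuity_2d; auto.
      + apply continuous_RInt_param; auto; lra.
    - intros x Hx.
      assert (D1 : is_derive (fun z => y z r - y z s) x (yx x r - yx x s)).
      { apply (is_derive_minus (fun z => y z r) (fun z => y z s)); apply Dx; auto; lra. }
      assert (D2 : is_derive (fun z => y z r - y z s) x (RInt (yxt x) s r)).
      { apply (is_derive_ext_loc (fun z => RInt (yt z) s r)).
        - apply (filter_imp (fun z => 0 < z < 1)).
          + intros z Hz; apply RInt_is_derive_interior; [lra| | |].
            * intros q Hq; apply (ex_derive_continuous (y z)); eexists; apply Dt; lra.
            * intros q _; apply continuous_snd_of_continuity_2d; auto.
            * intros q Hq; apply Dt; lra.
          + apply filter_and; [apply (open_gt 0); lra|apply (open_lt 1); lra].
        - apply is_derive_RInt_continuous_param with 0 1; auto; try lra.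
          intros u q Hu Hq; apply Dxt; lra. }
      apply is_derive_unique in D1; apply is_derive_unique in D2; lra. }
  intros x t Hx Ht.
  (* The base time t / 2 is positive, so [H] applies, and lies below every r near t. *)
  apply (is_derive_ext_loc (fun r => yx x (t / 2) + RInt (yxt x) (t / 2) r)).
  - apply (filter_imp (fun r => t / 2 < r)); [|apply (open_gt (t / 2)); lra].
    intros r Hr; specialize (H (t / 2) r ltac:(lra) x Hx); lra.
  - replace (yxt x t) with (0 + yxt x t) by ring.
    apply (is_derive_plus (fun _ => yx x (t / 2)) (fun r => RInt (yxt x) (t / 2) r)).
    + apply (is_derive_const (V := R_NormedModule)).
    + assert (C : forall q, continuous (yxt x) q) by (intros; apply continuous_snd_of_continuity_2d; auto).
      apply (is_derive_RInt (yxt x) (RInt (yxt x) (t / 2)) (t / 2)); [|apply C].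
      apply filter_forall; intros r.
      apply (RInt_correct (V := R_CompleteNormedModule)), ex_RInt_of_continuous, C.
Qed.

(** * Energy and Lyapunov densities *)

(* The densities take [u = y], [p = y_x], [q = y_t]. *)
Definition energy_density (b v p q : R) : R :=
  1 / 2 * q ^ 2 + 1 / 2 * (1 - v ^ 2) * p ^ 2 + b / 8 * p ^ 4.

Definition lyapunov_density (b delta eta v u p q : R) : R :=
  energy_density b v p q + delta * (u * q + delta * u ^ 2 + eta / 4 * p ^ 4).

(** Completing the square: q^2/2 + delta u q + delta^2 u^2 = (q + delta u)^2/2 + (delta u)^2/2. *)
Lemma lyapunov_density_nonneg (b delta eta v u p q : R) :
  0 < b -> 0 < delta -> 0 < eta -> 0 <= v < 1 ->
  0 <= lyapunov_density b delta eta v u p q.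
Proof.
  intros Hb Hd He Hv; unfold lyapunov_density, energy_density.
  assert (0 < 1 - v ^ 2) by nra.
  pose proof (pow2_ge_0 p); pose proof (pow2_ge_0 (p ^ 2)).
  pose proof (pow2_ge_0 (q + delta * u)); pose proof (pow2_ge_0 (delta * u)).
  replace (p ^ 4) with ((p ^ 2) ^ 2) by ring.
  assert (0 <= (1 - v ^ 2) * p ^ 2) by nra.
  assert (0 <= b * (p ^ 2) ^ 2) by nra.
  assert (0 <= delta * eta * (p ^ 2) ^ 2) by (apply Rmult_le_pos; nra).
  lra.
Qed.

Lemma K_const_ge_1 (b delta eta v : R) :
  0 < b -> 0 < delta -> 0 < eta -> 1 <= K_const b delta eta v.
Proof.
  intros Hb Hd He; unfold K_const.
  assert (0 < 2 * eta / b) by (apply Rdiv_lt_0_compat; lra).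
  pose proof (Rmax_r ((1 + 2 * delta / PI) / (PI * (1 - v ^ 2))) (2 * eta / b)).
  nra.
Qed.

(* The excess [u^2 - p^2 / PI^2] integrates to a nonpositive number by Wirtinger's inequality. *)
Lemma lyapunov_density_le_energy_density (b delta eta v u p q : R) :
  0 < b -> 0 < delta -> 0 < eta -> 0 <= v < 1 ->
  lyapunov_density b delta eta v u p q
  <= K_const b delta eta v * energy_density b v p q
     + delta * (PI / 2 + delta) * (u ^ 2 - p ^ 2 / PI ^ 2).
Proof.
  intros Hb Hd He Hv; pose proof PI_RGT_0 as HPI.
  assert (Hw : 0 < 1 - v ^ 2) by nra.
  unfold lyapunov_density, K_const.
  pose proof (Rmax_l ((1 + 2 * delta / PI) / (PI * (1 - v ^ 2))) (2 * eta / b)) as M1.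
  pose proof (Rmax_r ((1 + 2 * delta / PI) / (PI * (1 - v ^ 2))) (2 * eta / b)) as M2.
  set (M := Rmax _ _) in *; clearbody M.
  (* [L1], [L2], [L3] compare the coefficients of p^2, q^2 and p^4. The two entries of the maximum
     in [K_const] are the values giving equality in [L1] and in [L3]; [L2] follows from [L1] since 1
     - v^2 <= 1. *)
  assert (L1 : (1 / (2 * PI) + delta / PI ^ 2) <= M * (1 / 2 * (1 - v ^ 2))).
  { apply Rle_trans with ((1 + 2 * delta / PI) / (PI * (1 - v ^ 2)) * (1 / 2 * (1 - v ^ 2))).
    - right; field; lra.
    - apply Rmult_le_compat_r; lra. }
  assert (L2 : 1 / (2 * PI) <= M * (1 / 2)).
  { assert (0 < delta / PI ^ 2) by (apply Rdiv_lt_0_compat; nra).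
    assert (0 < M).
    { apply Rlt_le_trans with (2 * eta / b); auto; apply Rdiv_lt_0_compat; lra. }
    nra. }
  assert (L3 : eta / 4 <= M * (b / 8)).
  { apply Rle_trans with (2 * eta / b * (b / 8)).
    - right; field; lra.
    - apply Rmult_le_compat_r; lra. }
  (* Young's inequality with weight PI: replacing u^2 by p^2 / PI^2 then gives p^2 the same
     coefficient 1 / (2 PI) as q^2. *)
  assert (L4 : u * q <= PI / 2 * u ^ 2 + 1 / (2 * PI) * q ^ 2).
  { assert (0 <= / (2 * PI) * (PI * u - q) ^ 2).
    { apply Rmult_le_pos; [left; apply Rinv_0_lt_compat; lra|apply pow2_ge_0]. }
    replace (PI / 2 * u ^ 2 + 1 / (2 * PI) * q ^ 2)
      with (u * q + / (2 * PI) * (PI * u - q) ^ 2) by (field; lra).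
    lra. }
  assert (E1 := Rmult_le_compat_r _ _ _ (pow2_ge_0 p) L1).
  assert (E2 := Rmult_le_compat_r _ _ _ (pow2_ge_0 q) L2).
  assert (E3 := Rmult_le_compat_r _ _ _ (pow2_ge_0 (p ^ 2)) L3).
  replace ((p ^ 2) ^ 2) with (p ^ 4) in E3 by ring.
  assert (S : u * q + delta * u ^ 2 + eta / 4 * p ^ 4
              <= M * energy_density b v p q + (PI / 2 + delta) * (u ^ 2 - p ^ 2 / PI ^ 2)).
  { unfold energy_density.
    replace ((PI / 2 + delta) * (u ^ 2 - p ^ 2 / PI ^ 2))
      with (PI / 2 * u ^ 2 + delta * u ^ 2 - (1 / (2 * PI) + delta / PI ^ 2) * p ^ 2)
      by (field; lra).
    lra. }
  assert (S' := Rmult_le_compat_l delta _ _ (Rlt_le _ _ Hd) S).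
  lra.
Qed.

(** The integrand of V' once the boundary terms are removed; [pt] stands for y_xt. *)
Definition dissipation_density (b delta eta v p q pt : R) : R :=
  delta * (- q ^ 2 + 2 * v * p * q - (1 - v ^ 2) * p ^ 2 - b / 2 * p ^ 4)
  - eta * p ^ 2 * pt ^ 2.

(** After 2 p q <= p^2 + q^2, the bracket is at most - (1 - v) q^2 - (1 - v - v^2) p^2 - b/2 p^4.
    The ratio c makes the p^2 coefficients agree exactly, while c <= 1 - v and c <= 2 settle q^2 and
    p^4. *)
Lemma dissipation_density_le (b delta eta v p q pt : R) :
  0 < b -> 0 < delta -> 0 < eta -> 0 <= v < 1 -> 0 < 1 - v - v ^ 2 ->
  dissipation_density b delta eta v p q pt
  <= - (2 * delta * ((1 - v - v ^ 2) / (1 - v ^ 2))) * energy_density b v p q.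
Proof.
  intros Hb Hd He Hv Hc; unfold dissipation_density, energy_density.
  assert (Hw : 0 < 1 - v ^ 2) by nra.
  set (c := (1 - v - v ^ 2) / (1 - v ^ 2)).
  assert (Ec : c * (1 - v ^ 2) = 1 - v - v ^ 2) by (unfold c; field; lra).
  (* (1 - v)(1 - v^2) exceeds 1 - v - v^2 by v^3. *)
  assert (Hc1 : c <= 1 - v).
  { apply Rmult_le_reg_r with (1 - v ^ 2); auto; rewrite Ec; nra. }
  assert (Hc0 : 0 <= c) by (left; apply Rdiv_lt_0_compat; auto).
  clearbody c.
  assert (0 <= eta * p ^ 2 * pt ^ 2).
  { apply Rmult_le_pos; [apply Rmult_le_pos; [lra|]|]; apply pow2_ge_0. }
  assert (S : - q ^ 2 + 2 * v * p * q - (1 - v ^ 2) * p ^ 2 - b / 2 * p ^ 4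
              <= - (2 * c) * (1 / 2 * q ^ 2 + 1 / 2 * (1 - v ^ 2) * p ^ 2 + b / 8 * p ^ 4)).
  { assert (0 <= v * (p - q) ^ 2) by (apply Rmult_le_pos; [lra|apply pow2_ge_0]).
    assert (0 <= (1 - v - c) * q ^ 2) by (apply Rmult_le_pos; [lra|apply pow2_ge_0]).
    assert (0 <= (2 - c) * b * (p ^ 2) ^ 2).
    { apply Rmult_le_pos; [apply Rmult_le_pos; lra|apply pow2_ge_0]. }
    assert (E : c * (1 - v ^ 2) * p ^ 2 = (1 - v - v ^ 2) * p ^ 2) by (rewrite Ec; ring).
    lra. }
  assert (S' := Rmult_le_compat_l delta _ _ (Rlt_le _ _ Hd) S).
  lra.
Qed.

(** * Decay for motions continuous on the whole plane *)

(* All functions are continuous on the whole plane, so that the two-sided integration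
   and differentiation lemmas apply; they satisfy the problem only on the strip. *)
Record regular_motion (b delta eta v : R) (y yx yt yxx yxt ytt yxxt : R -> R -> R) : Prop := {
  motion_cont_y : forall x t, continuity_2d_pt y x t;
  motion_cont_x : forall x t, continuity_2d_pt yx x t;
  motion_cont_t : forall x t, continuity_2d_pt yt x t;
  motion_cont_xx : forall x t, continuity_2d_pt yxx x t;
  motion_cont_xt : forall x t, continuity_2d_pt yxt x t;
  motion_cont_tt : forall x t, continuity_2d_pt ytt x t;
  motion_cont_xxt : forall x t, continuity_2d_pt yxxt x t;
  motion_x : forall x t, 0 < x < 1 -> 0 < t -> is_derive (fun s => y s t) x (yx x t);
  motion_xx : forall x t, 0 < x < 1 -> 0 < t -> is_derive (fun s => yx s t) x (yxx x t);
  motion_tx : forall x t, 0 < x < 1 -> 0 < t -> is_derive (fun s => yt s t) x (yxt x t);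
  motion_xtx : forall x t, 0 < x < 1 -> 0 < t -> is_derive (fun s => yxt s t) x (yxxt x t);
  motion_t : forall x t, 0 <= x <= 1 -> 0 < t -> is_derive (y x) t (yt x t);
  motion_tt : forall x t, 0 <= x <= 1 -> 0 < t -> is_derive (yt x) t (ytt x t);
  motion_equation : string_equation b delta eta v yx yt yxx yxt ytt yxxt;
  motion_ends : fixed_ends y
}.

Section Motion.

Context {b delta eta v : R} {y yx yt yxx yxt ytt yxxt : R -> R -> R}.
Context (M : regular_motion b delta eta v y yx yt yxx yxt ytt yxxt).

Let Cy := motion_cont_y _ _ _ _ _ _ _ _ _ _ _ M.
Let Cx := motion_cont_x _ _ _ _ _ _ _ _ _ _ _ M.
Let Ct := motion_cont_t _ _ _ _ _ _ _ _ _ _ _ M.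
Let Cxx := motion_cont_xx _ _ _ _ _ _ _ _ _ _ _ M.
Let Cxt := motion_cont_xt _ _ _ _ _ _ _ _ _ _ _ M.
Let Ctt := motion_cont_tt _ _ _ _ _ _ _ _ _ _ _ M.
Let Cxxt := motion_cont_xxt _ _ _ _ _ _ _ _ _ _ _ M.
Let Dy_x := motion_x _ _ _ _ _ _ _ _ _ _ _ M.
Let Dyx_x := motion_xx _ _ _ _ _ _ _ _ _ _ _ M.
Let Dyt_x := motion_tx _ _ _ _ _ _ _ _ _ _ _ M.
Let Dyxt_x := motion_xtx _ _ _ _ _ _ _ _ _ _ _ M.
Let Dy_t := motion_t _ _ _ _ _ _ _ _ _ _ _ M.
Let Dyt_t := motion_tt _ _ _ _ _ _ _ _ _ _ _ M.
Let Heq := motion_equation _ _ _ _ _ _ _ _ _ _ _ M.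
Let Hends := motion_ends _ _ _ _ _ _ _ _ _ _ _ M.

Lemma end_velocity_zero (x t : R) : x = 0 \/ x = 1 -> 0 < t -> yt x t = 0.
Proof.
  intros Hx Ht.
  assert (D : is_derive (y x) t (yt x t)).
  { apply Dy_t; auto; destruct Hx; subst; lra. }
  assert (Z : is_derive (y x) t 0).
  { apply (is_derive_ext_loc (fun _ => 0)); [|apply (is_derive_const (V := R_NormedModule))].
    apply (filter_imp (fun s => 0 < s)); [|apply (open_gt 0); lra].
    intros s Hs; destruct (Hends s (Rlt_le _ _ Hs)).
    destruct Hx; subst; auto. }
  apply is_derive_unique in D; apply is_derive_unique in Z; lra.
Qed.

(** * The Lyapunov function as one integral, and its time derivative *)

Let ldens (t x : R) : R := lyapunov_density b delta eta v (y x t) (yx x t) (yt x t).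
Let edens (t x : R) : R := energy_density b v (yx x t) (yt x t).

Let ldens_t (t x : R) : R :=
  yt x t * ytt x t + (1 - v ^ 2) * yx x t * yxt x t + b / 2 * yx x t ^ 3 * yxt x t
  + delta * (yt x t ^ 2 + y x t * ytt x t + 2 * delta * y x t * yt x t
             + eta * yx x t ^ 3 * yxt x t).

Lemma continuity_2d_ldens (t x : R) : continuity_2d_pt ldens t x.
Proof.
  apply (continuity_2d_pt_swap (fun x t => ldens t x)).
  unfold ldens, lyapunov_density, energy_density; continuity_2d; auto.
Qed.

Lemma continuity_2d_edens (t x : R) : continuity_2d_pt edens t x.
Proof.
  apply (continuity_2d_pt_swap (fun x t => edens t x)).
  unfold edens, energy_density; continuity_2d; auto.
Qed.

Lemma continuity_2d_ldens_t (t x : R) : continuity_2d_pt ldens_t t x.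
Proof.
  apply (continuity_2d_pt_swap (fun x t => ldens_t t x)).
  unfold ldens_t; continuity_2d; auto.
Qed.

Lemma continuous_slice (F : R -> R -> R) (t x : R) :
  (forall x t, continuity_2d_pt F x t) -> continuous (fun s => F s t) x.
Proof.
  intros CF; apply continuous_fst_of_continuity_2d, CF.
Qed.

Lemma lyapunov_eq_RInt_density (t : R) :
  lyapunov b delta eta v y yx yt t = RInt (ldens t) 0 1.
Proof.
  assert (I : forall F : R -> R -> R, (forall x t, continuity_2d_pt F x t) ->
              ex_RInt (fun x => F x t) 0 1).
  { intros F CF; apply ex_RInt_of_continuous; intros x; apply continuous_slice, CF. }
  unfold lyapunov, energy, ldens, lyapunov_density, energy_density.
  rewrite <- RInt_Rmult.
  2:{ apply (I (fun x t => y x t * yt x t + delta * y x t ^ 2 + eta / 4 * yx x t ^ 4)).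
      intros; continuity_2d; auto. }
  rewrite <- RInt_Rplus.
  2:{ apply (I (fun x t => 1 / 2 * yt x t ^ 2)); intros; continuity_2d; auto. }
  2:{ apply (I (fun x t => 1 / 2 * (1 - v ^ 2) * yx x t ^ 2)); intros; continuity_2d; auto. }
  rewrite <- RInt_Rplus.
  2:{ apply (I (fun x t => 1 / 2 * yt x t ^ 2 + 1 / 2 * (1 - v ^ 2) * yx x t ^ 2));
      intros; continuity_2d; auto. }
  2:{ apply (I (fun x t => b / 8 * yx x t ^ 4)); intros; continuity_2d; auto. }
  rewrite <- RInt_Rplus; auto.
  - apply (I (fun x t => 1 / 2 * yt x t ^ 2 + 1 / 2 * (1 - v ^ 2) * yx x t ^ 2
                         + b / 8 * yx x t ^ 4)); intros; continuity_2d; auto.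
  - apply (I (fun x t => delta * (y x t * yt x t + delta * y x t ^ 2 + eta / 4 * yx x t ^ 4)));
      intros; continuity_2d; auto.
Qed.

Lemma is_derive_lyapunov (t : R) :
  0 < t -> is_derive (lyapunov b delta eta v y yx yt) t (RInt (ldens_t t) 0 1).
Proof.
  intros Ht; apply (is_derive_ext (fun t => RInt (ldens t) 0 1)).
  { intros s; symmetry; apply lyapunov_eq_RInt_density. }
  apply is_derive_RInt_continuous_param with 0 (t + 1); try lra.
  - apply continuity_2d_ldens.
  - apply continuity_2d_ldens_t.
  - intros s x Hs Hx; destruct Hs as [Hs _].
    pose proof (Dy_t x s Hx Hs) as D.
    pose proof (Dyt_t x s Hx Hs) as Dt.
    (* [yxt] is given as the x-derivative of y_t; here it must be the t-derivative of y_x. *)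
    assert (Dx : is_derive (yx x) s (yxt x s)).
    { apply (is_derive_mixed_partial y yx yt yxt); auto; apply M. }
    unfold ldens, lyapunov_density, energy_density; auto_derive.
    + repeat split; eexists; eassumption.
    + rewrite (is_derive_unique (fun z : R => y x z) _ _ D).
      rewrite (is_derive_unique (fun z : R => yt x z) _ _ Dt).
      rewrite (is_derive_unique (fun z : R => yx x z) _ _ Dx).
      unfold ldens_t; field.
Qed.

(* The boundary terms vanish because [y] and [y_t] do at both ends. *)
Lemma RInt_ldens_t (t : R) :
  0 < t ->
  RInt (ldens_t t) 0 1
  = RInt (fun x => dissipation_density b delta eta v (yx x t) (yt x t) (yxt x t)) 0 1.
Proof.
  intros Ht.
  set (stress := fun x t => (1 - v ^ 2) * yx x t + b / 2 * yx x t ^ 3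
                            + eta * yx x t ^ 2 * yxt x t).
  set (stress_x := fun x t => (1 - v ^ 2 + 3 / 2 * b * yx x t ^ 2) * yxx x t
                              + 2 * eta * yx x t * yxx x t * yxt x t
                              + eta * yx x t ^ 2 * yxxt x t).
  (* The last two terms absorb the transport term: - 2 v y_xt (y_t + delta y) is the x-derivative of
     - v y_t^2 - 2 v delta y y_t, plus 2 v delta y_x y_t, which remains in the dissipation. *)
  set (flux := fun x t => (yt x t + delta * y x t) * stress x t
                          - v * yt x t ^ 2 - 2 * v * delta * y x t * yt x t).
  set (flux_x := fun x t =>
         (yxt x t + delta * yx x t) * stress x t + (yt x t + delta * y x t) * stress_x x t
         - 2 * v * yt x t * yxt x t
         - 2 * v * delta * (yx x t * yt x t + y x t * yxt x t)).
  assert (B : RInt (fun x => flux_x x t) 0 1 = 0).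
  { transitivity (flux 1 t - flux 0 t).
    - apply (RInt_is_derive_interior (fun x => flux x t)); try lra.
      + intros x _; apply continuous_slice; intros; unfold flux, stress; continuity_2d; auto.
      + intros x _; apply continuous_slice; intros; unfold flux_x, stress, stress_x;
          continuity_2d; auto.
      + intros x Hx.
        pose proof (Dy_x x t Hx Ht) as D.
        pose proof (Dyx_x x t Hx Ht) as Dx.
        pose proof (Dyt_x x t Hx Ht) as Dt.
        pose proof (Dyxt_x x t Hx Ht) as Dxt.
        unfold flux, stress; auto_derive.
        * repeat split; eexists; eassumption.
        * rewrite (is_derive_unique (fun z : R => y z t) _ _ D).
          rewrite (is_derive_unique (fun z : R => yx z t) _ _ Dx).
          rewrite (is_derive_unique (fun z : R => yt z t) _ _ Dt).
          rewrite (is_derive_unique (fun z : R => yxt z t) _ _ Dxt).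
          unfold flux_x, stress, stress_x; field.
    - destruct (Hends t (Rlt_le _ _ Ht)) as [Y0 Y1].
      unfold flux; rewrite Y0, Y1, !end_velocity_zero by auto.
      change ((0 + delta * 0) * stress 1 t - v * 0 ^ 2 - 2 * v * delta * 0 * 0
              - ((0 + delta * 0) * stress 0 t - v * 0 ^ 2 - 2 * v * delta * 0 * 0) = 0 :> R).
      ring. }
  transitivity (RInt (fun x => flux_x x t) 0 1
    + RInt (fun x => dissipation_density b delta eta v (yx x t) (yt x t) (yxt x t)) 0 1);
    [|rewrite B; apply Rplus_0_l].
  rewrite <- RInt_Rplus.
  - apply RInt_ext; rewrite Rmin_left, Rmax_right by lra; intros x Hx.
    pose proof (Heq x t Hx (Rlt_le _ _ Ht)) as E.
    fold (stress_x x t) in E.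
    assert (E' : ytt x t = stress_x x t - 2 * delta * yt x t - 2 * v * yxt x t) by lra.
    (* A pointwise identity. The terms delta y^2 and eta/4 y_x^4 of V are there to cancel 2 delta^2
       y y_t, produced by the damping, and delta eta y_x^3 y_xt, produced by delta y_x times the
       stress. *)
    unfold ldens_t, flux_x, dissipation_density; rewrite E'; unfold stress.
    match goal with |- ?a = ?b => change (a = b :> R) end; field.
  - apply ex_RInt_of_continuous; intros x; apply continuous_slice; intros;
      unfold flux_x, stress, stress_x; continuity_2d; auto.
  - apply ex_RInt_of_continuous; intros x.
    apply (continuous_slice (fun x t => dissipation_density b delta eta v (yx x t) (yt x t) (yxt x t))).
    intros; unfold dissipation_density; continuity_2d; auto.
Qed.

(** * Comparison with the energy, and decay *)

Context (Hb : 0 < b).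
Context (Hdelta : 0 < delta).
Context (Heta : 0 < eta).
Context (Hv : 0 <= v < 1).

Lemma ex_RInt_ldens (t : R) : ex_RInt (ldens t) 0 1.
Proof.
  apply ex_RInt_of_continuous; intros; apply continuous_snd_of_continuity_2d, continuity_2d_ldens.
Qed.

Lemma ex_RInt_edens (t : R) : ex_RInt (edens t) 0 1.
Proof.
  apply ex_RInt_of_continuous; intros; apply continuous_snd_of_continuity_2d, continuity_2d_edens.
Qed.

Lemma lyapunov_nonneg (t : R) : 0 <= lyapunov b delta eta v y yx yt t.
Proof.
  rewrite lyapunov_eq_RInt_density; apply RInt_ge_0; [lra|apply ex_RInt_ldens|].
  intros; apply lyapunov_density_nonneg; auto.
Qed.

Lemma lyapunov_le_energy (t : R) :
  0 < t -> RInt (ldens t) 0 1 <= K_const b delta eta v * RInt (edens t) 0 1.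
Proof.
  intros Ht; pose proof PI_RGT_0 as HPI.
  set (k := delta * (PI / 2 + delta)).
  assert (Hk : 0 < k) by (unfold k; apply Rmult_lt_0_compat; lra).
  assert (I1 : ex_RInt (fun x => y x t ^ 2) 0 1).
  { apply ex_RInt_of_continuous; intros x; apply (continuous_slice (fun x t => y x t ^ 2)).
    intros; continuity_2d; auto. }
  assert (I2 : ex_RInt (fun x => yx x t ^ 2) 0 1).
  { apply ex_RInt_of_continuous; intros x; apply (continuous_slice (fun x t => yx x t ^ 2)).
    intros; continuity_2d; auto. }
  assert (W : PI ^ 2 * RInt (fun x => y x t ^ 2) 0 1 <= RInt (fun x => yx x t ^ 2) 0 1).
  { destruct (Hends t (Rlt_le _ _ Ht)).
    apply (wirtinger (fun x => y x t) (fun x => yx x t)); auto.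
    - intros; apply continuous_slice; auto.
    - intros; apply continuous_slice; auto. }
  set (A := RInt (fun x => y x t ^ 2) 0 1) in *.
  set (B := RInt (fun x => yx x t ^ 2) 0 1) in *.
  (* The added term is the integral of the pointwise excess; it equals - (k / PI^2)(B - PI^2 A),
     nonpositive by [W]. *)
  apply Rle_trans with (K_const b delta eta v * RInt (edens t) 0 1 + (k * A + - (k / PI ^ 2) * B)).
  - unfold A, B; rewrite <- !RInt_Rmult by (auto; apply ex_RInt_edens).
    assert (J1 : ex_RInt (fun x => K_const b delta eta v * edens t x) 0 1)
      by apply (ex_RInt_scal (edens t)), ex_RInt_edens.
    assert (J2 : ex_RInt (fun x => k * y x t ^ 2) 0 1)
      by apply (ex_RInt_scal (fun x => y x t ^ 2)), I1.
    assert (J3 : ex_RInt (fun x => - (k / PI ^ 2) * yx x t ^ 2) 0 1)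
      by apply (ex_RInt_scal (fun x => yx x t ^ 2)), I2.
    assert (J4 := ex_RInt_plus _ _ _ _ J2 J3).
    rewrite <- !RInt_Rplus by auto.
    apply RInt_le; [lra|apply ex_RInt_ldens|exact (ex_RInt_plus _ _ _ _ J1 J4)|].
    intros x _.
    pose proof (lyapunov_density_le_energy_density b delta eta v (y x t) (yx x t) (yt x t)
                  Hb Hdelta Heta Hv) as L.
    fold k (edens t x) (ldens t x) in L.
    replace (k * y x t ^ 2 + - (k / PI ^ 2) * yx x t ^ 2)
      with (k * (y x t ^ 2 - yx x t ^ 2 / PI ^ 2)) by (field; lra).
    exact L.
  - assert (k * A + - (k / PI ^ 2) * B = - (k / PI ^ 2) * (B - PI ^ 2 * A)) by (field; lra).
    assert (0 <= k / PI ^ 2 * (B - PI ^ 2 * A)).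
    { apply Rmult_le_pos; [left; apply Rdiv_lt_0_compat; nra|lra]. }
    lra.
Qed.

Lemma lyapunov_decay (t : R) :
  0 < 1 - v - v ^ 2 -> 0 <= t ->
  lyapunov b delta eta v y yx yt t
  <= lyapunov b delta eta v y yx yt 0
     * exp (- (2 * delta * (1 - v - v ^ 2) / (K_const b delta eta v * (1 - v ^ 2))) * t).
Proof.
  intros Hvc Ht.
  assert (Hw : 0 < 1 - v ^ 2) by nra.
  pose proof (K_const_ge_1 b delta eta v Hb Hdelta Heta) as HK.
  set (K := K_const b delta eta v) in *.
  set (r := 2 * delta * (1 - v - v ^ 2) / (K * (1 - v ^ 2))).
  assert (Hr : 0 < r).
  { apply Rdiv_lt_0_compat; [|apply Rmult_lt_0_compat; lra].
    apply Rmult_lt_0_compat; lra. }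
  apply gronwall_exp with (fun s => RInt (ldens_t s) 0 1); auto.
  (* Gronwall's lemma starts at time 0, where only continuity is at hand; the derivative is known
     for positive times. *)
  - intros s _; apply (continuous_ext (fun s => RInt (ldens s) 0 1)).
    + intros u; symmetry; apply lyapunov_eq_RInt_density.
    + apply continuous_RInt_param; [lra|apply continuity_2d_ldens].
  - intros s Hs; apply is_derive_lyapunov; lra.
  - intros s Hs; rewrite RInt_ldens_t, lyapunov_eq_RInt_density by lra.
    (* r K = 2 delta c is the rate of dissipation relative to the energy; V <= K E then trades the
       energy for V. *)
    apply Rle_trans with (- (r * K) * RInt (edens s) 0 1).
    + replace (r * K) with (2 * delta * ((1 - v - v ^ 2) / (1 - v ^ 2)))
        by (unfold r; field; lra).
      rewrite <- RInt_Rmult by apply ex_RInt_edens.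
      apply RInt_le; [lra| | |].
      * apply ex_RInt_of_continuous; intros x.
        apply (continuous_slice
                 (fun x t => dissipation_density b delta eta v (yx x t) (yt x t) (yxt x t))).
        intros; unfold dissipation_density; continuity_2d; auto.
      * apply (ex_RInt_scal (edens s)), ex_RInt_edens.
      * intros x _; apply dissipation_density_le; auto.
    + pose proof (lyapunov_le_energy s ltac:(lra)) as L; fold K in L.
      assert (L' := Rmult_le_compat_l r _ _ (Rlt_le _ _ Hr) L); lra.
Qed.

End Motion.

(** * Extension from the strip *)

(** Retracting the plane onto the strip preserves joint continuity but can break differentiability
    across an edge. Hence [regular_motion] asks for derivatives only at t > 0, and for those in x
    only when 0 < x < 1. *)
Definition extend_strip (u : R -> R -> R) (x t : R) : R := u (clip 0 1 x) (Rmax 0 t).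

Lemma extend_strip_eq (u : R -> R -> R) (x t : R) :
  0 <= x <= 1 -> 0 <= t -> extend_strip u x t = u x t.
Proof.
  intros Hx Ht; unfold extend_strip; rewrite clip_id, Rmax_right; auto.
Qed.

(** The retraction is 1-Lipschitz in each variable, so the radius obtained on the strip serves
    unchanged. *)
Lemma continuity_2d_extend_strip (u : R -> R -> R) (x t : R) :
  continuous_strip u -> continuity_2d_pt (extend_strip u) x t.
Proof.
  intros Cu eps.
  pose proof (clip_range 0 1 x ltac:(lra)) as Hx; pose proof (Rmax_l 0 t) as Ht.
  pose proof (Cu (clip 0 1 x, Rmax 0 t) (conj Hx Ht)) as C.
  apply filterlim_locally with (eps := eps) in C.
  destruct C as [d Hd]; exists d; intros a c Ha Hc.
  apply (Hd (clip 0 1 a, Rmax 0 c)).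
  - split; simpl.
    + apply Rle_lt_trans with (Rabs (a - x)); [apply clip_lipschitz|exact Ha].
    + apply Rle_lt_trans with (Rabs (c - t)); [|exact Hc].
      unfold minus, plus, opp, abs, Rmax; simpl.
      repeat destruct Rle_dec; unfold Rabs; repeat destruct Rcase_abs; lra.
  - split; [apply clip_range; lra|apply Rmax_l].
Qed.

(** Small increments stay inside D, so the limit within D is the two-sided one. *)
Lemma is_derive_of_D_in (f df : R -> R) (D : R -> Prop) (x : R) :
  locally x D -> D_in f df D x -> is_derive f x (df x).
Proof.
  intros [d Hd] H; apply is_derive_Reals; intros eps Heps.
  destruct (H eps Heps) as [e [He Hlim]].
  assert (Hm : 0 < Rmin d e) by (apply Rmin_case; [apply cond_pos|exact He]).
  exists (mkposreal _ Hm); simpl; intros h Hh0 Hh.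
  pose proof (Rmin_l d e); pose proof (Rmin_r d e).
  specialize (Hlim (x + h)); simpl in Hlim; unfold Rdist in Hlim.
  replace (x + h - x) with h in Hlim by ring.
  apply Hlim; split; [split|].
  - apply Hd; change (Rabs (x + h - x) < d); replace (x + h - x) with h by ring; lra.
  - lra.
  - lra.
Qed.

Lemma is_derive_extend_strip_x (u ux : R -> R -> R) (x t : R) :
  partial_x u ux -> 0 < x < 1 -> 0 < t ->
  is_derive (fun s => extend_strip u s t) x (extend_strip ux x t).
Proof.
  intros P Hx Ht.
  assert (L : locally x (fun s => 0 < s < 1)).
  { apply filter_and; [apply (open_gt 0); lra|apply (open_lt 1); lra]. }
  rewrite extend_strip_eq by lra.
  apply (is_derive_ext_loc (fun s => u s t)).
  - revert L; apply filter_imp; intros s Hs; symmetry; apply extend_strip_eq; lra.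
  - apply (is_derive_of_D_in (fun s => u s t) (fun s => ux s t) unit_interval).
    + revert L; apply filter_imp; unfold unit_interval; intros; lra.
    + apply P; unfold unit_interval, half_line; lra.
Qed.

Lemma is_derive_extend_strip_t (u ut : R -> R -> R) (x t : R) :
  partial_t u ut -> 0 <= x <= 1 -> 0 < t ->
  is_derive (extend_strip u x) t (extend_strip ut x t).
Proof.
  intros P Hx Ht.
  assert (L : locally t (fun s => 0 < s)) by (apply (open_gt 0); lra).
  rewrite extend_strip_eq by lra.
  apply (is_derive_ext_loc (u x)).
  - revert L; apply filter_imp; intros s Hs; symmetry; apply extend_strip_eq; lra.
  - apply (is_derive_of_D_in (u x) (ut x) half_line).
    + revert L; apply filter_imp; unfold half_line; intros; lra.
    + apply P; unfold unit_interval, half_line; lra.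
Qed.

Lemma regular_motion_extend_strip (b delta eta v : R) (y yx yt yxx yxt ytt yxxt : R -> R -> R) :
  classical_regularity y yx yt yxx yxt ytt yxxt ->
  string_equation b delta eta v yx yt yxx yxt ytt yxxt ->
  fixed_ends y ->
  regular_motion b delta eta v (extend_strip y) (extend_strip yx) (extend_strip yt)
    (extend_strip yxx) (extend_strip yxt) (extend_strip ytt) (extend_strip yxxt).
Proof.
  intros [] E F; constructor.
  1-7: intros; apply continuity_2d_extend_strip; assumption.
  1-4: intros; apply is_derive_extend_strip_x; assumption.
  1-2: intros; apply is_derive_extend_strip_t; assumption.
  - intros x t Hx Ht; rewrite !extend_strip_eq by lra; apply E; auto.
  - intros t Ht; rewrite !extend_strip_eq by lra; apply F; auto.
Qed.

Lemma lyapunov_extend_strip (b delta eta v : R) (y yx yt : R -> R -> R) (t : R) :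
  0 <= t ->
  lyapunov b delta eta v (extend_strip y) (extend_strip yx) (extend_strip yt) t
  = lyapunov b delta eta v y yx yt t.
Proof.
  intros Ht; unfold lyapunov, energy; f_equal; [f_equal; [f_equal|]|f_equal];
    apply RInt_ext; rewrite Rmin_left, Rmax_right by lra; intros x Hx;
    rewrite !extend_strip_eq by lra; reflexivity.
Qed.

(** * The critical speed and the conclusion *)

(** [v_crit] is the positive root: 1 - v - v^2 = (v_crit - v)(v + (sqrt 5 + 1)/2). *)
Lemma v_crit_pos_margin (v : R) : 0 <= v < v_crit -> 0 < 1 - v - v ^ 2.
Proof.
  unfold v_crit; intros Hv.
  assert (S : sqrt 5 * sqrt 5 = 5) by (apply sqrt_sqrt; lra).
  pose proof (sqrt_pos 5); nra.
Qed.

Theorem theorem2p3 :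
  forall (b delta eta v : R) (f g : R -> R)
    (y yx yt yxx yxt ytt yxxt : R -> R -> R),
  0 < b -> 0 < delta -> 0 < eta -> 0 <= v < 1 ->
  C1_unit_interval f ->
  ((exists x, 0 <= x <= 1 /\ f x <> 0) \/ (exists x, 0 <= x <= 1 /\ g x <> 0)) ->
  classical_regularity y yx yt yxx yxt ytt yxxt ->
  string_equation b delta eta v yx yt yxx yxt ytt yxxt ->
  fixed_ends y ->
  initial_data f g y yt ->
  0 <= v < v_crit ->
  (forall t, 0 <= t ->
    lyapunov b delta eta v y yx yt t
    <= lyapunov b delta eta v y yx yt 0
       * exp (- (2 * delta * (1 - v - v ^ 2)
                 / (K_const b delta eta v * (1 - v ^ 2))) * t))
  /\ tends_to_zero_exponentially (lyapunov b delta eta v y yx yt).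
Proof.
  intros b delta eta v f g y yx yt yxx yxt ytt yxxt Hb Hd He Hv _ _ Hreg Heq Hends _ Hvc.
  apply v_crit_pos_margin in Hvc.
  pose proof (regular_motion_extend_strip _ _ _ _ _ _ _ _ _ _ _ Hreg Heq Hends) as M.
  assert (decay : forall t, 0 <= t ->
    lyapunov b delta eta v y yx yt t
    <= lyapunov b delta eta v y yx yt 0
       * exp (- (2 * delta * (1 - v - v ^ 2)
                 / (K_const b delta eta v * (1 - v ^ 2))) * t)).
  { intros t Ht; rewrite <- !(lyapunov_extend_strip b delta eta v y yx yt) by lra.
    apply (lyapunov_decay M); auto. }
  split; [exact decay|].
  exists (lyapunov b delta eta v y yx yt 0).
  (* Unification with [decay] fixes the rate; nonnegativity of V removes the absolute value. *)
  eexists; split; [|intros t Ht; rewrite Rabs_pos_eq; [apply decay, Ht|]].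
  - pose proof (K_const_ge_1 b delta eta v Hb Hd He).
    apply Rdiv_lt_0_compat; apply Rmult_lt_0_compat; nra.
  - rewrite <- (lyapunov_extend_strip b delta eta v y yx yt) by lra.
    apply (lyapunov_nonneg M); auto.
Qed.
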